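(* Let $\pi\in(0,1)$ and set $\phi_1=\frac{2-\pi}{3-\pi}$. Let $\phi_0$, with $\phi_0<\phi_1$, be the unique solution in $\phi\in(0,1)$ of $g^*(\phi)=g_0(\phi)$ (its existence being presupposed in (i) and (ii); the functions $g^*,g_0$ are defined in the context). Let $\phi\in(0,1)$ with $\pi(1-\pi)(1-\phi)<1/4$, and regard the fundamental price of the blockchain $f_B$ as a function of $\theta\in[\theta_0,1]$. Then: (i) If $\phi<\phi_0$, then $f_B$ is monotonically increasing in $\theta$. (ii) If $\phi_0\le\phi<\phi_1$, then $f_B$ is U-shaped: there is $\theta^*$ such that $\frac{df_B}{d\theta}\lessgtr 0\iff\theta\lessgtr\theta^*$. (iii) If $\phi_1\le\phi\le1$, then $f_B$ is monotonically decreasing in $\theta$.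
   Context: Two platforms, the blockchain market ($B$) and the cash market ($C$), trade an asset of high or low quality. $\pi\in(0,1)$ is the economy-wide fraction of high-quality assets, $\phi\in(0,1)$ (standing assumption) is the relative value of a low-quality asset, and $\theta$ is the probability that a low-quality asset offered in $B$ is detected and rejected. Private values $\alpha$ are uniform on $[0,1]$. $\pi_B$ is the fraction of high-quality assets among assets traded in $B$, the corresponding fraction in $C$ is $0$, $\tilde\pi_B=\pi_B+(1-\pi_B)\phi$ and $\tilde\pi_C=\phi$. An equilibrium is a tuple $(Q,P_B,P_C,\pi_B,K_B,K_C)$ with $P_B,P_C>0$, $K_B>0$, $K_C\ge 0$ such that both markets clear, $K_j=K_j^S=K_j^D$ for $j\in\{B,C\}$, where $$\alpha_I=\max\Big\{\tfrac{P_C-(1-\theta)P_B}{\phi\theta},0\Big\},$$ $$K_C^S=(1-\pi)\alpha_I,\qquad K_B^S=\pi P_B+(1-\pi)(1-\theta)\Big(\tfrac{P_B}{\phi}-\alpha_I\Big),$$ $$K_B^D=1-\frac{P_B-P_C}{\tilde\pi_B-\phi},\qquad K_C^D=\frac{P_B-P_C}{\tilde\pi_B-\phi}-\frac{P_C}{\phi},$$ $$\pi_B=\frac{\pi P_B}{K_B},\qquad Q=P_BK_B .$$ Note that $\tilde\pi_B-\phi=(1-\phi)\pi_B$. $\theta_0=\theta_0(\phi)\in(0,1)$ is the smaller root of $\theta^2(1-\pi)-\theta+\pi(1-\phi)=0$; for $\theta\in[\theta_0,1]$ the equilibrium exists and is unique. Derivatives at the endpoints of $[\theta_0,1]$ are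 one-sided. With $\alpha^*=\frac{P_B-P_C}{\tilde\pi_B-\tilde\pi_C}$, the fundamental price of the blockchain (maximal ex-ante access fee for buyers) is $$f_B=\int_{\alpha^*}^1\big((\tilde\pi_B-\tilde\pi_C)\alpha-(P_B-P_C)\big)\,d\alpha .$$ The functions used to define $\phi_0$ are $$g^*(\phi)=\frac{2\pi\big(2-\pi-\phi(3-\pi)\big)}{(1-\pi)\big(1-\pi(1-\phi)+\frac{\phi\pi}{2-\pi}\big)},\qquad g_0(\phi)=\frac{1-\theta_0(\phi)}{\theta_0(\phi)} .$$ *)

(* Defs.v *)
From Stdlib Require Import Reals Lra Psatz.
From Coquelicot Require Import Coquelicot.
Open Scope R_scope.

(* Candidate equilibrium (Q, P_B, P_C, pi_B, K_B, K_C) of the blockchain (B)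
   and cash (C) platforms: value P_B K_B traded in B, prices, share of high-quality assets among
   those traded in B (in C it is 0), and traded quantities. *)
Record market := Market {
  Q_B : R;
  P_B : R;
  P_C : R;
  pi_B : R;
  K_B : R;
  K_C : R
}.

(* Throughout, [pi] is the economy-wide share of high-quality assets, [phi] the
   relative value of a low-quality asset, and [theta] the probability that a
   low-quality asset offered in B is rejected. *)
Definition tpi_B (phi : R) (e : market) : R := pi_B e + (1 - pi_B e) * phi.
Definition tpi_C (phi : R) : R := phi.

Definition alpha_I (phi theta : R) (e : market) : R :=
  Rmax ((P_C e - (1 - theta) * P_B e) / (phi * theta)) 0.

Definition K_C_supply (pi phi theta : R) (e : market) : R :=
  (1 - pi) * alpha_I phi theta e.
Definition K_B_supply (pi phi theta : R) (e : market) : R :=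
  pi * P_B e
  + (1 - pi) * (1 - theta) * (P_B e / phi - alpha_I phi theta e).
Definition K_B_demand (phi : R) (e : market) : R :=
  1 - (P_B e - P_C e) / (tpi_B phi e - phi).
Definition K_C_demand (phi : R) (e : market) : R :=
  (P_B e - P_C e) / (tpi_B phi e - phi) - P_C e / phi.

Definition is_equilibrium (pi phi theta : R) (e : market) : Prop :=
  (0 < P_B e /\ 0 < P_C e /\ 0 < K_B e /\ 0 <= K_C e) /\
  (K_B e = K_B_supply pi phi theta e /\ K_B e = K_B_demand phi e) /\
  (K_C e = K_C_supply pi phi theta e /\ K_C e = K_C_demand phi e) /\
  pi_B e = pi * P_B e / K_B e /\
  Q_B e = P_B e * K_B e.

Definition alpha_star (phi : R) (e : market) : R :=
  (P_B e - P_C e) / (tpi_B phi e - tpi_C phi).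

Definition f_B (phi : R) (e : market) : R :=
  RInt (fun alpha => (tpi_B phi e - tpi_C phi) * alpha - (P_B e - P_C e))
       (alpha_star phi e) 1.

(* Smaller root of theta^2 (1 - pi) - theta + pi (1 - phi) = 0, by the
   quadratic formula; [theta0_spec] states this property. *)
Definition theta0 (pi phi : R) : R :=
  (1 - sqrt (1 - 4 * (1 - pi) * (pi * (1 - phi)))) / (2 * (1 - pi)).

Lemma theta0_spec (pi phi : R) : 0 < pi < 1 -> 0 < phi < 1 ->
  0 < theta0 pi phi < 1 /\
  theta0 pi phi ^ 2 * (1 - pi) - theta0 pi phi + pi * (1 - phi) = 0 /\
  (forall t, t ^ 2 * (1 - pi) - t + pi * (1 - phi) = 0 -> theta0 pi phi <= t).
Proof.
intros Hpi Hphi; unfold theta0.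
set (D := 1 - 4 * (1 - pi) * (pi * (1 - phi))).
assert (Hq : 0 < (1 - pi) * pi) by (apply Rmult_lt_0_compat; lra).
assert (Hq1 : 0 < (1 - pi) * pi * phi) by (apply Rmult_lt_0_compat; lra).
assert (Hq2 : 0 < (1 - pi) * pi * (1 - phi)) by (apply Rmult_lt_0_compat; lra).
assert (HD : (1 - 2 * pi) * (1 - 2 * pi) < D) by (unfold D; lra).
assert (HD0 : 0 <= D) by (pose proof (Rle_0_sqr (1 - 2 * pi)); unfold Rsqr in *; lra).
assert (HD1 : D < 1) by (unfold D; lra).
assert (Hs0 := sqrt_pos D).
assert (Hs2 : sqrt D * sqrt D = D) by (apply sqrt_sqrt; exact HD0).
set (s := sqrt D) in *; clearbody s.
assert (Hs1 : s < 1) by nra.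
assert (Hs3 : 2 * pi - 1 < s) by nra.
set (t0 := (1 - s) / (2 * (1 - pi))).
assert (Ht0 : 2 * (1 - pi) * t0 = 1 - s) by (unfold t0; field; lra).
assert (Hroot : t0 ^ 2 * (1 - pi) - t0 + pi * (1 - phi) = 0).
{ apply (Rmult_eq_reg_l (4 * (1 - pi))); [|lra].
  transitivity ((2 * (1 - pi) * t0) * (2 * (1 - pi) * t0)
                - 2 * (2 * (1 - pi) * t0) + (1 - D)).
  - unfold D; ring.
  - rewrite Ht0, <- Hs2; ring. }
split; [split; nra | split; [exact Hroot |]].
intros t Ht.
destruct (Rle_lt_dec t0 t) as [Hle | Hlt]; [exact Hle | exfalso].
assert (H : (t - t0) * ((1 - pi) * (t + t0) - 1) = 0) by lra.
assert ((1 - pi) * (t + t0) - 1 < 0) by nra.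
nra.
Qed.

Definition g_star (pi phi : R) : R :=
  2 * pi * (2 - pi - phi * (3 - pi))
  / ((1 - pi) * (1 - pi * (1 - phi) + phi * pi / (2 - pi))).

Definition g0 (pi phi : R) : R := (1 - theta0 pi phi) / theta0 pi phi.

Definition phi1 (pi : R) : R := (2 - pi) / (3 - pi).

Definition is_phi0 (pi phi0 : R) : Prop :=
  0 < phi0 < 1 /\ g_star pi phi0 = g0 pi phi0 /\
  (forall phi, 0 < phi < 1 -> g_star pi phi = g0 pi phi -> phi = phi0).

Definition increasing_on (a b : R) (f : R -> R) : Prop :=
  forall x y, a <= x -> x < y -> y <= b -> f x < f y.
Definition decreasing_on (a b : R) (f : R -> R) : Prop :=
  forall x y, a <= x -> x < y -> y <= b -> f y < f x.

(* [D_in f df D x] is the derivative of [f] at [x] relative to [D]: it is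
   two-sided at interior points of [a, b] and one-sided at [a] and [b].
   Since [xs < b], there is always an increasing part; the decreasing part
   vanishes when [xs = a]. *)
Definition U_shaped_on (a b : R) (f : R -> R) : Prop :=
  exists (df : R -> R) (xs : R),
    a <= xs < b /\
    forall x, a <= x <= b ->
      D_in f df (fun t => a <= t <= b) x /\
      (df x < 0 <-> x < xs) /\
      (df x > 0 <-> x > xs).

(* Main.v *)
Require Import Defs.
From Stdlib Require Import Reals Lra Psatz.
From Coquelicot Require Import Coquelicot.
Open Scope R_scope.

(** In the discount [x = 1 - P_C / P_B] market clearing becomes one polynomial
    equation, quadratic in [x] and affine in [theta], whose positive root
    increases with [theta].  Since demand in B is [K_B = 1 - alpha_star], the
    fee is [f_B = (1 - phi) pi P_B K_B / 2], and eliminating [theta] makes it a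
    constant divided by [fee_denom], a concave parabola in [x].  So [f_B]
    falls until [x] reaches the vertex of the parabola and rises afterwards.
    The vertex is reached where [(1 - theta) / theta = g_star]; as [g_star]
    decreases and [g0] increases in [phi], comparing [phi] with [phi0] decides
    whether this happens before [theta0], and [phi] with [phi1] whether it
    happens before [1]. *)

(** * Reduction of an equilibrium to its price discount *)

Definition discount_poly (pi phi theta x : R) : R :=
  (1 - pi) * (1 - theta) * x ^ 2
  + (theta * (pi * phi + pi * (1 - phi) * (2 - pi))
     + pi * (1 - phi) * (1 - pi) * (1 - theta)) * x
  - pi * (1 - phi) * (2 - pi) * theta.

(** In equilibrium the first factor is [pi (1 - phi) / K_B] and the second is [phi / P_B]. *)
Definition fee_denom (pi phi x : R) : R :=
  (pi * (1 - phi) + x) * ((2 - pi) * (1 - x) + pi * phi).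

Definition fee (pi phi x : R) : R :=
  phi * (pi * (1 - phi)) ^ 2 / (2 * fee_denom pi phi x).

(** Midpoint of the two roots [- pi (1 - phi)] and [1 + pi phi / (2 - pi)] of [fee_denom]. *)
Definition vertex (pi phi : R) : R :=
  (2 - pi + pi * phi - (2 - pi) * (pi * (1 - phi))) / (2 * (2 - pi)).

Lemma RInt_affine_from_zero (u v : R) :
  u <> 0 -> RInt (fun a => u * a - v) (v / u) 1 = u * (1 - v / u) ^ 2 / 2.
Proof.
intros Hu; apply is_RInt_unique.
replace (u * (1 - v / u) ^ 2 / 2)
  with (minus ((fun a => u * a ^ 2 / 2 - v * a) 1)
              ((fun a => u * a ^ 2 / 2 - v * a) (v / u)))
  by (unfold minus, plus, opp; simpl; field; exact Hu).
apply (is_RInt_derive (fun a => u * a ^ 2 / 2 - v * a)).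
- intros a _; auto_derive; [exact I | lra].
- intros a _; apply (ex_derive_continuous (V := R_NormedModule)); auto_derive; exact I.
Qed.

Lemma theta0_eq_of_quadratic_nonneg (pi phi theta : R) :
  0 < pi < 1 -> 0 < phi < 1 -> theta0 pi phi <= theta <= 1 ->
  0 <= theta ^ 2 * (1 - pi) - theta + pi * (1 - phi) ->
  theta = theta0 pi phi.
Proof.
intros Hpi Hphi Ht Hq.
destruct (theta0_spec pi phi Hpi Hphi) as [H01 [H0 _]].
set (t0 := theta0 pi phi) in *; clearbody t0.
destruct (Req_dec theta t0) as [|Hne]; [assumption | exfalso].
assert (Hlt : t0 < theta) by lra.
assert (Hfac : 0 <= (theta - t0) * ((1 - pi) * (theta + t0) - 1)) by lra.
assert (H1 : 0 <= (1 - pi) * (theta + t0) - 1) by nra.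
(* [1] lies strictly between the two roots of the quadratic. *)
assert (Hv : (1 - t0) * ((1 - pi) * (1 + t0) - 1) = - (pi * phi)) by lra.
assert (0 < pi * phi) by nra.
assert ((1 - pi) * (1 + t0) - 1 < 0) by nra.
assert (0 <= (1 - pi) * (1 - theta)) by nra.
lra.
Qed.

(** The definition of [pi_B] makes the valuation gap [pi (1 - phi) P_B / K_B], so [alpha_star] is
    [x K_B / (pi (1 - phi))] and demand in B determines [K_B] from [x] alone. *)
Lemma equilibrium_discount (pi phi theta : R) (e : market) :
  0 < pi < 1 -> 0 < phi < 1 -> theta0 pi phi <= theta <= 1 ->
  is_equilibrium pi phi theta e ->
  exists x, 0 < x < 1 /\ discount_poly pi phi theta x = 0 /\
            f_B phi e = fee pi phi x.
Proof.
intros Hpi Hphi Ht [[HP [HC [HK HKC]]] [[HKs HKd] [[HCs HCd] [Hb _]]]].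
destruct (theta0_spec pi phi Hpi Hphi) as [Ht0 _].
unfold f_B, alpha_star, K_B_supply, K_B_demand, K_C_supply, K_C_demand,
  alpha_I, tpi_B, tpi_C in *.
destruct e as [Q p c b K L]; simpl in *.
assert (Hth : 0 < theta) by lra.
assert (HD : 0 < pi * (1 - phi)) by nra.
assert (Hu : b + (1 - b) * phi - phi = pi * (1 - phi) * p / K)
  by (rewrite Hb; field; lra).
rewrite Hu in *.
assert (Hu0 : 0 < pi * (1 - phi) * p / K)
  by (apply Rdiv_lt_0_compat; [nra | exact HK]).
set (x := 1 - c / p).
assert (Hc : c = p * (1 - x)) by (unfold x; field; lra).
assert (Hx1 : x < 1).
{ unfold x; assert (0 < c / p) by (apply Rdiv_lt_0_compat; lra); lra. }
clearbody x; subst c.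
assert (Hq : (p - p * (1 - x)) / (pi * (1 - phi) * p / K)
             = x * K / (pi * (1 - phi))) by (field; repeat split; lra).
assert (HKx : K * (pi * (1 - phi) + x) = pi * (1 - phi)).
{ rewrite Hq in HKd.
  transitivity (pi * (1 - phi) * (K + x * K / (pi * (1 - phi)))); [field; lra|].
  replace (K + x * K / (pi * (1 - phi))) with 1 by lra; ring. }
assert (HL : x * K / (pi * (1 - phi)) = 1 - K) by lra.
rewrite Hq, HL in HCd.
(* [K_C >= 0] and [P_C > 0] force [K < 1], which [HKx] allows only for positive [x]. *)
assert (Hx0 : 0 < x).
{ assert (0 < p * (1 - x) / phi) by (apply Rdiv_lt_0_compat; nra).
  assert (K < 1) by lra. nra. }
assert (Hd : pi * (1 - phi) * (1 - K) = K * x) by lra.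
(* If the [Rmax] clipped a negative value, clearing would put [theta] strictly
   outside the two roots of the quadratic defining [theta0]. *)
assert (Ha : Rmax ((p * (1 - x) - (1 - theta) * p) / (phi * theta)) 0
             = p * (theta - x) / (phi * theta)).
{ replace ((p * (1 - x) - (1 - theta) * p) / (phi * theta))
    with (p * (theta - x) / (phi * theta)) by (field; lra).
  destruct (Rle_lt_dec x theta) as [Hle | Hlt].
  - apply Rmax_left, Rdiv_le_0_compat; nra.
  - exfalso.
    assert (Hneg : p * (theta - x) / (phi * theta) <= 0).
    { apply Rmult_le_0_r; [nra | apply Rlt_le, Rinv_0_lt_compat; nra]. }
    replace ((p * (1 - x) - (1 - theta) * p) / (phi * theta))
      with (p * (theta - x) / (phi * theta)) in * by (field; lra).
    rewrite Rmax_right in * by exact Hneg.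
    assert (HE1 : K * phi = p * (pi * phi + (1 - pi) * (1 - theta)))
      by (rewrite HKs; field; lra).
    assert (HE2 : p * (1 - x) = phi * (1 - K)).
    { replace (1 - K) with (p * (1 - x) / phi) by lra; field; lra. }
    assert (Hx : x * (1 - (1 - pi) * theta) = pi * (1 - phi)).
    { apply (Rmult_eq_reg_l p); [|lra].
      transitivity (x * (p * (pi * phi + (1 - pi) * (1 - theta)))
                    + pi * (1 - phi) * x * p); [ring|].
      rewrite <- HE1.
      transitivity (phi * (K * x) + pi * (1 - phi) * x * p); [ring|].
      rewrite <- Hd.
      transitivity (pi * (1 - phi) * (phi * (1 - K)) + pi * (1 - phi) * x * p);
        [ring|].
      rewrite <- HE2; ring. }
    assert (Hpos : 0 < 1 - (1 - pi) * theta) by nra.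
    (* Replacing [x] by the smaller [theta] in [Hx] makes its left side drop below
       [pi (1 - phi)]. *)
    assert (Hquad : 0 < theta ^ 2 * (1 - pi) - theta + pi * (1 - phi)) by nra.
    assert (Heq := theta0_eq_of_quadratic_nonneg pi phi theta Hpi Hphi Ht
                     (Rlt_le _ _ Hquad)).
    destruct (theta0_spec pi phi Hpi Hphi) as [_ [Hroot _]].
    rewrite <- Heq in Hroot; lra. }
rewrite Ha in *.
assert (HE1 : K * phi * theta = p * (pi * phi * theta + (1 - pi) * (1 - theta) * x))
  by (rewrite HKs; field; lra).
assert (HE2 : (1 - pi) * p * (theta - x) + theta * p * (1 - x)
              = phi * theta * (1 - K)).
{ replace (1 - K) with ((1 - pi) * (p * (theta - x) / (phi * theta))
                        + p * (1 - x) / phi) by lra.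
  field; lra. }
(* Adding [HE1] and [HE2] cancels [K], and a factor [theta] divides out. *)
assert (Hp : p * ((2 - pi) * (1 - x) + pi * phi) = phi).
{ apply (Rmult_eq_reg_l theta); lra. }
exists x; split; [lra | split].
- unfold discount_poly; apply (Rmult_eq_reg_l p); [|lra].
  (* [x] times clearing in B minus [pi (1 - phi)] times clearing in C: by [Hd] the quantities
     cancel. *)
  transitivity (x * (p * (pi * phi * theta + (1 - pi) * (1 - theta) * x))
                - pi * (1 - phi) * ((1 - pi) * p * (theta - x) + theta * p * (1 - x)));
    [ring|].
  rewrite <- HE1, HE2.
  transitivity (phi * theta * (K * x - pi * (1 - phi) * (1 - K))); [ring|].
  rewrite Hd; ring.
- rewrite RInt_affine_from_zero by lra.
  rewrite Hq, HL; unfold fee, fee_denom.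
  set (A := (2 - pi) * (1 - x) + pi * phi) in *.
  assert (HA : 0 < A) by (unfold A; nra).
  replace (1 - (1 - K)) with K by ring.
  set (D := pi * (1 - phi)) in *.
  clearbody A D.
  assert (HK' : K = D / (D + x)) by (rewrite <- HKx at 1; field; lra).
  rewrite <- Hp, HK'; field; repeat split; lra.
Qed.

(** * Monotonicity and uniqueness of the clearing discount *)

Lemma discount_poly_increasing (pi phi theta theta' x x' : R) :
  0 < pi < 1 -> 0 < phi < 1 -> 0 < theta -> theta < theta' -> theta' <= 1 ->
  0 < x -> 0 < x' ->
  discount_poly pi phi theta x = 0 -> discount_poly pi phi theta' x' = 0 ->
  x < x'.
Proof.
intros Hpi Hphi Ht Htt Ht1 Hx Hx' H H'.
unfold discount_poly in *.
assert (HD : 0 < pi * (1 - phi)) by nra.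
assert (HB : 0 < pi * phi) by nra.
destruct (Rlt_le_dec x x') as [|Hle]; [assumption | exfalso].
set (D := pi * (1 - phi)) in *; set (B := pi * phi) in *; clearbody D B.
set (q := 1 - pi) in *.
set (m := 2 - pi) in *.
assert (Hm : 0 < m) by (unfold m; lra).
assert (Hq : 0 < q) by (unfold q; lra).
clearbody q m.
(* At fixed [theta'] the polynomial increases in [x]; at fixed root [x] of
   [theta], it decreases in [theta]. *)
assert (Hmono : q * (1 - theta') * x' ^ 2
    + (theta' * (B + D * m) + D * q * (1 - theta')) * x'
    <= q * (1 - theta') * x ^ 2
    + (theta' * (B + D * m) + D * q * (1 - theta')) * x).
{ apply Rplus_le_compat.
  - apply Rmult_le_compat_l; [nra | apply pow_incr; lra].
  - apply Rmult_le_compat_l; [|lra].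
    assert (0 < D * m) by nra. assert (0 < D * q) by nra. nra. }
(* The polynomial is affine in [theta] with value [q x (x + D)] at [theta = 0]; eliminating its
   slope between [theta] and [theta'] leaves only that value. *)
assert (Hs : theta * (q * (1 - theta') * x ^ 2
    + (theta' * (B + D * m) + D * q * (1 - theta')) * x - D * m * theta')
    = - (theta' - theta) * (q * x * (x + D))).
{ transitivity (theta' * (q * (1 - theta) * x ^ 2
    + (theta * (B + D * m) + D * q * (1 - theta)) * x - D * m * theta)
    - (theta' - theta) * (q * x * (x + D))); [ring | rewrite H; ring]. }
assert (0 < (theta' - theta) * (q * x * (x + D)))
  by (apply Rmult_lt_0_compat; [lra | apply Rmult_lt_0_compat; nra]).
nra.
Qed.

Lemma discount_poly_root_unique (pi phi theta x y : R) :
  0 < pi < 1 -> 0 < phi < 1 -> 0 < theta <= 1 -> 0 < x -> 0 < y ->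
  discount_poly pi phi theta x = 0 -> discount_poly pi phi theta y = 0 -> x = y.
Proof.
intros Hpi Hphi Ht Hx Hy H H'.
unfold discount_poly in *.
assert (HD : 0 < pi * (1 - phi)) by nra.
assert (HB : 0 < pi * phi) by nra.
set (D := pi * (1 - phi)) in *; set (B := pi * phi) in *; clearbody D B.
assert (HDm : 0 < D * (2 - pi)) by nra.
assert (HDq : 0 < D * (1 - pi)) by nra.
assert (Hc : 0 <= (1 - pi) * (1 - theta)) by nra.
assert (Hfac : (x - y) * ((1 - pi) * (1 - theta) * (x + y)
   + (theta * (B + D * (2 - pi)) + D * (1 - pi) * (1 - theta))) = 0) by lra.
apply Rmult_integral in Hfac; destruct Hfac as [|Hz]; [lra | exfalso].
assert (0 <= (1 - pi) * (1 - theta) * (x + y)) by nra.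
assert (0 < theta * (B + D * (2 - pi))) by nra.
assert (0 <= D * (1 - pi) * (1 - theta)) by nra.
lra.
Qed.

(** * The fee as a function of the discount *)

Lemma fee_denom_pos (pi phi x : R) :
  0 < pi < 1 -> 0 < phi < 1 -> 0 < x < 1 -> 0 < fee_denom pi phi x.
Proof.
intros Hpi Hphi Hx; unfold fee_denom; apply Rmult_lt_0_compat; nra.
Qed.

Lemma fee_lt (pi phi x y : R) :
  0 < pi < 1 -> 0 < phi < 1 -> 0 < x < 1 -> 0 < y < 1 ->
  fee_denom pi phi x < fee_denom pi phi y -> fee pi phi y < fee pi phi x.
Proof.
intros Hpi Hphi Hx Hy H.
assert (Hpos := fee_denom_pos pi phi x Hpi Hphi Hx).
unfold fee; apply Rmult_lt_compat_l.
- apply Rmult_lt_0_compat; [lra | apply pow_lt; nra].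
- apply Rinv_lt_contravar; nra.
Qed.

(** The parabola has leading coefficient [- (2 - pi)], so the comparison depends only on which side
    of [vertex] the midpoint of [x] and [y] lies. *)
Lemma fee_denom_sub (pi phi x y : R) : pi < 1 ->
  fee_denom pi phi y - fee_denom pi phi x
  = (y - x) * (2 - pi) * (2 * vertex pi phi - (x + y)).
Proof.
intros Hpi; unfold fee_denom, vertex; field; lra.
Qed.

Lemma fee_decreasing (pi phi x y : R) :
  0 < pi < 1 -> 0 < phi < 1 -> 0 < x -> x < y -> y < 1 -> y <= vertex pi phi ->
  fee pi phi y < fee pi phi x.
Proof.
intros Hpi Hphi Hx Hxy Hy Hv; apply fee_lt; try lra.
assert (Hs := fee_denom_sub pi phi x y (proj2 Hpi)).
assert (0 < (y - x) * (2 - pi) * (2 * vertex pi phi - (x + y)))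
  by (apply Rmult_lt_0_compat; nra).
lra.
Qed.

Lemma fee_increasing (pi phi x y : R) :
  0 < pi < 1 -> 0 < phi < 1 -> 0 < x -> x < y -> y < 1 -> vertex pi phi <= x ->
  fee pi phi x < fee pi phi y.
Proof.
intros Hpi Hphi Hx Hxy Hy Hv; apply fee_lt; try lra.
assert (Hs := fee_denom_sub pi phi y x (proj2 Hpi)).
assert (0 < (y - x) * (2 - pi) * ((x + y) - 2 * vertex pi phi))
  by (apply Rmult_lt_0_compat; nra).
lra.
Qed.

(** * Explicit discount and differentiation in [theta] *)

Definition linear_coef (pi phi theta : R) : R :=
  theta * (pi * phi + pi * (1 - phi) * (2 - pi))
  + pi * (1 - phi) * (1 - pi) * (1 - theta).

Definition discriminant (pi phi theta : R) : R :=
  linear_coef pi phi theta ^ 2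
  + 4 * ((1 - pi) * (1 - theta)) * (pi * (1 - phi) * (2 - pi) * theta).

(* Written with the root in the denominator: at [theta = 1] the leading
   coefficient of the quadratic vanishes. *)
Definition discount (pi phi theta : R) : R :=
  2 * (pi * (1 - phi) * (2 - pi) * theta)
  / (linear_coef pi phi theta + sqrt (discriminant pi phi theta)).

Lemma linear_coef_pos (pi phi theta : R) :
  0 < pi < 1 -> 0 < phi < 1 -> 0 < theta <= 1 -> 0 < linear_coef pi phi theta.
Proof.
intros Hpi Hphi Ht; unfold linear_coef.
assert (0 < pi * (1 - phi)) by nra.
assert (0 < pi * phi) by nra.
assert (0 < pi * (1 - phi) * (2 - pi)) by nra.
assert (0 < pi * (1 - phi) * (1 - pi)) by nra.
nra.
Qed.

Lemma discriminant_pos (pi phi theta : R) :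
  0 < pi < 1 -> 0 < phi < 1 -> 0 < theta <= 1 -> 0 < discriminant pi phi theta.
Proof.
intros Hpi Hphi Ht; unfold discriminant.
assert (HB := linear_coef_pos pi phi theta Hpi Hphi Ht).
assert (HDm : 0 < pi * (1 - phi) * (2 - pi) * theta)
  by (apply Rmult_lt_0_compat; [apply Rmult_lt_0_compat; nra | lra]).
assert (Ha : 0 <= (1 - pi) * (1 - theta)) by nra.
assert (0 < linear_coef pi phi theta ^ 2) by (apply pow_lt; lra).
nra.
Qed.

Lemma discount_pos (pi phi theta : R) :
  0 < pi < 1 -> 0 < phi < 1 -> 0 < theta <= 1 -> 0 < discount pi phi theta.
Proof.
intros Hpi Hphi Ht; unfold discount.
assert (HB := linear_coef_pos pi phi theta Hpi Hphi Ht).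
assert (H := sqrt_pos (discriminant pi phi theta)).
apply Rdiv_lt_0_compat; [|lra].
assert (0 < pi * (1 - phi) * (2 - pi)) by (apply Rmult_lt_0_compat; nra).
nra.
Qed.

(** Stated under positivity instead of [theta <= 1], so that it also holds just beyond [theta = 1],
    where a two-sided derivative is taken. *)
Lemma discount_root (pi phi theta : R) :
  0 < linear_coef pi phi theta -> 0 < discriminant pi phi theta ->
  discount_poly pi phi theta (discount pi phi theta) = 0.
Proof.
unfold discount, discount_poly; intros HB HR.
assert (Hs0 := sqrt_pos (discriminant pi phi theta)).
assert (Hs := sqrt_sqrt _ (Rlt_le _ _ HR)).
set (s := sqrt _) in *; clearbody s.
unfold discriminant in *; fold (linear_coef pi phi theta).
set (B := linear_coef pi phi theta) in *; clearbody B.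
set (c := pi * (1 - phi) * (2 - pi) * theta) in *.
set (a := (1 - pi) * (1 - theta)) in *; clearbody a c.
apply (Rmult_eq_reg_r ((B + s) ^ 2)); [|apply pow_nonzero; lra].
transitivity (c * (B ^ 2 + 4 * a * c - s * s)); [field; lra | rewrite Hs; ring].
Qed.

Lemma ex_derive_discount (pi phi theta : R) :
  0 < linear_coef pi phi theta -> 0 < discriminant pi phi theta ->
  ex_derive (discount pi phi) theta.
Proof.
intros HB HR.
assert (Hs := sqrt_pos (discriminant pi phi theta)).
unfold discount, discriminant, linear_coef in *.
auto_derive; split; [exact HR | split; [|exact I]].
exact (Rgt_not_eq _ _ (Rplus_lt_le_0_compat _ _ HB Hs)).
Qed.

Lemma locally_pos (f : R -> R) (x : R) :
  ex_derive f x -> 0 < f x -> locally x (fun t => 0 < f t).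
Proof.
intros Hf Hx.
exact (ex_derive_continuous f x Hf (fun y => 0 < y) (open_gt 0 (f x) Hx)).
Qed.

(** Implicit differentiation of the root equation. Strict monotonicity alone would give only a
    nonnegative derivative, while the U-shape needs a strict sign. *)
Lemma Derive_discount_pos (pi phi theta : R) :
  0 < pi < 1 -> 0 < phi < 1 -> 0 < theta <= 1 ->
  0 < Derive (discount pi phi) theta.
Proof.
intros Hpi Hphi Ht.
assert (HB := linear_coef_pos pi phi theta Hpi Hphi Ht).
assert (HR := discriminant_pos pi phi theta Hpi Hphi Ht).
assert (HX := discount_pos pi phi theta Hpi Hphi Ht).
assert (HP := discount_root pi phi theta HB HR).
assert (Hex := ex_derive_discount pi phi theta HB HR).
set (X := discount pi phi) in *.
assert (Hloc : locally theta (fun t => 0 = discount_poly pi phi t (X t))).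
{ assert (H1 : locally theta (fun t => 0 < linear_coef pi phi t))
    by (apply locally_pos; [unfold linear_coef; auto_derive; exact I | exact HB]).
  assert (H2 : locally theta (fun t => 0 < discriminant pi phi t)).
  { apply locally_pos; [|exact HR].
    unfold discriminant, linear_coef; auto_derive; exact I. }
  generalize (filter_and _ _ H1 H2); apply filter_imp.
  intros t [Ht1 Ht2]; symmetry; exact (discount_root pi phi t Ht1 Ht2). }
assert (Hd : is_derive (fun t => discount_poly pi phi t (X t)) theta
   ((2 * (1 - pi) * (1 - theta) * X theta + linear_coef pi phi theta)
      * Derive X theta
    + (- (1 - pi) * X theta ^ 2
       + (pi * phi + pi * (1 - phi) * (2 - pi) - pi * (1 - phi) * (1 - pi)) * X theta
       - pi * (1 - phi) * (2 - pi)))).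
{ unfold discount_poly; auto_derive; [tauto|].
  change (fun t => X t) with X; unfold linear_coef; ring. }
assert (H0 := eq_trans (eq_sym (is_derive_unique _ _ _ Hd))
  (is_derive_unique _ _ _
    (is_derive_ext_loc _ _ _ _ Hloc (is_derive_const 0 theta)))).
unfold zero in H0; simpl in H0.
set (l := Derive X theta) in *; clearbody l.
set (x := X theta) in *; clearbody x.
unfold discount_poly in HP.
assert (HD : 0 < pi * (1 - phi)) by nra.
assert (Hc : 0 <= (1 - pi) * (1 - theta)) by nra.
assert (Hcoef : 0 < 2 * (1 - pi) * (1 - theta) * x + linear_coef pi phi theta)
  by nra.
(* Multiplying by [theta] and subtracting the equation satisfied by [x]
   cancels the derivative in [theta] up to [(1 - pi) x (x + D)]. *)
assert (Hl : (2 * (1 - pi) * (1 - theta) * x + linear_coef pi phi theta)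
             * (theta * l) = (1 - pi) * x * (x + pi * (1 - phi))).
{ apply (Rmult_eq_compat_l theta) in H0; lra. }
assert (Hrhs : 0 < (1 - pi) * x * (x + pi * (1 - phi)))
  by (apply Rmult_lt_0_compat; nra).
assert (0 < theta * l) by nra.
nra.
Qed.

Lemma is_derive_fee (pi phi x : R) :
  0 < pi < 1 -> 0 < phi < 1 -> 0 < x < 1 ->
  is_derive (fee pi phi) x
    (phi * (pi * (1 - phi)) ^ 2 * (2 - pi) * (x - vertex pi phi)
     / fee_denom pi phi x ^ 2).
Proof.
intros Hpi Hphi Hx.
assert (Hpos := fee_denom_pos pi phi x Hpi Hphi Hx).
unfold fee, fee_denom, vertex in *.
auto_derive; [lra | field; split; [nra | split; nra]].
Qed.

(** Equilibria are given only on [[theta0, 1]]; this transfers the derivative of a smooth extension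
    of the fee, including at the endpoints. *)
Lemma is_derive_D_in (f g : R -> R) (df : R -> R) (D : R -> Prop) (x : R) :
  D x -> (forall t, D t -> g t = f t) -> is_derive f x (df x) -> D_in g df D x.
Proof.
intros HDx Hfg Hf.
apply is_derive_Reals, derivable_pt_lim_D_in in Hf.
intros eps Heps; destruct (Hf eps Heps) as [del [Hdel H]].
exists del; split; [exact Hdel|].
intros t [[HDt Hne] Hdist].
rewrite !Hfg by assumption.
apply H; split; [split; [exact I | exact Hne] | exact Hdist].
Qed.

(** * Comparison of [g_star] with [g0] *)

Lemma theta0_decreasing (pi phi phi' : R) :
  0 < pi < 1 -> 0 < phi -> phi < phi' -> phi' < 1 ->
  theta0 pi phi' < theta0 pi phi.
Proof.
intros Hpi Hphi Hlt Hphi'.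
assert (0 < (1 - pi) * pi) by nra.
unfold theta0; apply Rmult_lt_compat_r; [apply Rinv_0_lt_compat; lra|].
apply Rplus_lt_compat_l, Ropp_lt_contravar, sqrt_lt_1_alt; split; [|nra].
assert (0 < (1 - pi) * pi * phi) by nra.
(* The radicand equals [(1 - 2 pi)^2 + 4 (1 - pi) pi phi]. *)
assert (0 <= (1 - 2 * pi) ^ 2) by apply pow2_ge_0.
lra.
Qed.

Lemma g0_increasing (pi phi phi' : R) :
  0 < pi < 1 -> 0 < phi -> phi < phi' -> phi' < 1 -> g0 pi phi < g0 pi phi'.
Proof.
intros Hpi Hphi Hlt Hphi'; unfold g0.
destruct (theta0_spec pi phi Hpi) as [H1 _]; [lra|].
destruct (theta0_spec pi phi' Hpi) as [H2 _]; [lra|].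
assert (H := theta0_decreasing pi phi phi' Hpi Hphi Hlt Hphi').
set (t := theta0 pi phi) in *; set (t' := theta0 pi phi') in *; clearbody t t'.
replace ((1 - t) / t) with (/ t - 1) by (field; lra).
replace ((1 - t') / t') with (/ t' - 1) by (field; lra).
assert (/ t < / t') by (apply Rinv_lt_contravar; nra); lra.
Qed.

(** [phi1] is the zero of the numerator of [g_star]. *)
Lemma lt_phi1 (pi phi : R) :
  pi < 1 -> phi < phi1 pi <-> 0 < 2 - pi - phi * (3 - pi).
Proof.
intros Hpi; unfold phi1.
assert (H : (2 - pi) / (3 - pi) * (3 - pi) = 2 - pi) by (field; lra).
split; intros; nra.
Qed.

Lemma g_star_denom_pos (pi phi : R) : 0 < pi < 1 -> 0 < phi < 1 ->
  0 < (1 - pi) * (1 - pi * (1 - phi) + phi * pi / (2 - pi)).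
Proof.
intros Hpi Hphi.
assert (0 < phi * pi / (2 - pi)) by (apply Rdiv_lt_0_compat; nra).
apply Rmult_lt_0_compat; nra.
Qed.

(** Below [phi1] the numerator is positive and falls, while the positive denominator rises. *)
Lemma g_star_decreasing (pi phi phi' : R) :
  0 < pi < 1 -> 0 < phi -> phi < phi' -> phi' < 1 -> phi' < phi1 pi ->
  g_star pi phi' < g_star pi phi.
Proof.
intros Hpi Hphi Hlt Hphi' H1.
apply lt_phi1 in H1; [|lra].
assert (HN : 2 - pi - phi' * (3 - pi) < 2 - pi - phi * (3 - pi)) by nra.
assert (Hd := g_star_denom_pos pi phi Hpi ltac:(lra)).
assert (Hd' := g_star_denom_pos pi phi' Hpi ltac:(lra)).
assert (HDD : (1 - pi) * (1 - pi * (1 - phi) + phi * pi / (2 - pi))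
  < (1 - pi) * (1 - pi * (1 - phi') + phi' * pi / (2 - pi))).
{ apply Rmult_lt_compat_l; [lra|].
  assert (phi * pi / (2 - pi) < phi' * pi / (2 - pi))
    by (apply Rmult_lt_compat_r; [apply Rinv_0_lt_compat; lra | nra]).
  nra. }
unfold g_star; apply Rmult_le_0_lt_compat.
- nra.
- apply Rlt_le, Rinv_0_lt_compat; exact Hd'.
- nra.
- apply Rinv_lt_contravar; [apply Rmult_lt_0_compat; assumption | exact HDD].
Qed.

(** * Location of the turning point *)

Lemma vertex_pos (pi phi : R) : 0 < pi < 1 -> 0 < phi < 1 -> 0 < vertex pi phi.
Proof.
intros Hpi Hphi; unfold vertex; apply Rdiv_lt_0_compat; [|lra].
assert (0 < pi * phi) by nra.
assert (pi * (1 - phi) < 1) by nra.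
nra.
Qed.

(** Divided by [theta], the root equation is affine in [(1 - theta) / theta]; solving it at
    [x = vertex] yields [g_star]. *)
Lemma vertex_root (pi phi : R) : 0 < pi < 1 -> 0 < phi < 1 ->
  0 <= g_star pi phi ->
  discount_poly pi phi (/ (1 + g_star pi phi)) (vertex pi phi) = 0.
Proof.
intros Hpi Hphi Hg.
assert (Hd := g_star_denom_pos pi phi Hpi Hphi).
assert (Hg1 : 1 + g_star pi phi <> 0) by lra.
apply (Rmult_eq_reg_l (1 + g_star pi phi)); [|exact Hg1].
set (g := g_star pi phi) in *.
transitivity ((1 - pi) * g * vertex pi phi ^ 2
  + (pi * phi + pi * (1 - phi) * (2 - pi) + pi * (1 - phi) * (1 - pi) * g)
    * vertex pi phi - pi * (1 - phi) * (2 - pi)).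
{ unfold discount_poly; field; exact Hg1. }
subst g; clear Hg1 Hg; unfold g_star, vertex.
assert (1 - pi * (1 - phi) + phi * pi / (2 - pi) <> 0) by nra.
assert ((1 - pi * (1 - phi)) * (2 - pi) + phi * pi <> 0).
{ replace ((1 - pi * (1 - phi)) * (2 - pi) + phi * pi)
    with ((1 - pi * (1 - phi) + phi * pi / (2 - pi)) * (2 - pi)) by (field; lra).
  apply Rmult_integral_contrapositive_currified; lra. }
field; repeat split; lra.
Qed.

Lemma discount_increasing (pi phi theta theta' : R) :
  0 < pi < 1 -> 0 < phi < 1 -> 0 < theta -> theta < theta' -> theta' <= 1 ->
  discount pi phi theta < discount pi phi theta'.
Proof.
intros Hpi Hphi Ht Hlt Ht1.
apply (discount_poly_increasing pi phi theta theta'); try lra;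
  first [apply discount_pos; lra | apply discount_root].
all: first [apply linear_coef_pos; lra | apply discriminant_pos; lra].
Qed.

Lemma root_eq_discount (pi phi theta x : R) :
  0 < pi < 1 -> 0 < phi < 1 -> 0 < theta <= 1 -> 0 < x ->
  discount_poly pi phi theta x = 0 -> x = discount pi phi theta.
Proof.
intros Hpi Hphi Ht Hx H.
apply (discount_poly_root_unique pi phi theta); try assumption.
- apply discount_pos; assumption.
- apply discount_root; [apply linear_coef_pos | apply discriminant_pos]; assumption.
Qed.

Lemma discount_at_vertex (pi phi : R) : 0 < pi < 1 -> 0 < phi < 1 ->
  0 <= g_star pi phi ->
  discount pi phi (/ (1 + g_star pi phi)) = vertex pi phi.
Proof.
intros Hpi Hphi Hg; symmetry; apply root_eq_discount; try assumption.
- split; [apply Rinv_0_lt_compat; lra|].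
  rewrite <- Rinv_1; apply Rinv_le_contravar; lra.
- apply vertex_pos; assumption.
- apply vertex_root; assumption.
Qed.

(** The value [1 / 2] separates the two: with [a = pi (1 - phi) (2 - pi)] and [b = pi phi], the
    discount at 1 is [a / (a + b)], [vertex] is [1 / 2 + (b - a) / (2 (2 - pi))], and [phi1 <= phi]
    means [a <= b]. *)
Lemma discount_1_le_vertex (pi phi : R) : 0 < pi < 1 -> 0 < phi < 1 ->
  phi1 pi <= phi -> discount pi phi 1 <= vertex pi phi.
Proof.
intros Hpi Hphi H1.
assert (HN : pi * (1 - phi) * (2 - pi) <= pi * phi).
{ destruct (Rlt_le_dec 0 (2 - pi - phi * (3 - pi))) as [Hlt|]; [|nra].
  apply lt_phi1 in Hlt; lra. }
assert (HX : discount_poly pi phi 1 (discount pi phi 1) = 0).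
{ apply discount_root; [apply linear_coef_pos | apply discriminant_pos]; lra. }
assert (HDm : 0 < pi * (1 - phi) * (2 - pi))
  by (apply Rmult_lt_0_compat; [apply Rmult_lt_0_compat|]; lra).
apply Rle_trans with (1 / 2).
- unfold discount_poly in HX; set (x := discount pi phi 1) in *; clearbody x.
  assert ((pi * phi + pi * (1 - phi) * (2 - pi)) * x
          = pi * (1 - phi) * (2 - pi)) by lra.
  nra.
- unfold vertex; apply (Rmult_le_reg_r (2 * (2 - pi))); [lra|].
  unfold Rdiv at 2; rewrite Rmult_assoc, Rinv_l by lra; lra.
Qed.

(** Puts [theta0] in the form of the turning point [/ (1 + g_star)], so that comparing them amounts
    to comparing [g0] with [g_star]. *)
Lemma theta0_eq_inv (pi phi : R) : 0 < pi < 1 -> 0 < phi < 1 ->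
  theta0 pi phi = / (1 + g0 pi phi).
Proof.
intros Hpi Hphi; destruct (theta0_spec pi phi Hpi Hphi) as [H _].
unfold g0; field; split; lra.
Qed.

(* [E theta] is the equilibrium at detection probability [theta]. *)
Theorem corollary2 :
  forall (pi phi : R) (E : R -> market),
    0 < pi < 1 ->
    0 < phi < 1 ->
    pi * (1 - pi) * (1 - phi) < 1 / 4 ->
    (forall theta, theta0 pi phi <= theta <= 1 ->
       is_equilibrium pi phi theta (E theta)) ->
    let fB := fun theta => f_B phi (E theta) in
    (forall phi0, is_phi0 pi phi0 -> phi0 < phi1 pi ->
       phi < phi0 -> increasing_on (theta0 pi phi) 1 fB) /\
    (forall phi0, is_phi0 pi phi0 -> phi0 < phi1 pi ->
       phi0 <= phi < phi1 pi -> U_shaped_on (theta0 pi phi) 1 fB) /\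
    (phi1 pi <= phi <= 1 -> decreasing_on (theta0 pi phi) 1 fB).
Proof.
intros pi phi E Hpi Hphi _ HE fB.
destruct (theta0_spec pi phi Hpi Hphi) as [Ht0 _].
assert (Hred : forall t, theta0 pi phi <= t <= 1 ->
  0 < discount pi phi t < 1 /\ fB t = fee pi phi (discount pi phi t)).
{ intros t Ht.
  destruct (equilibrium_discount pi phi t (E t) Hpi Hphi Ht (HE t Ht))
    as [x [Hx [Hroot Hf]]].
  rewrite <- (root_eq_discount pi phi t x); try assumption; try lra.
  split; assumption. }
assert (Hmono : forall s t, 0 < s -> s < t -> t <= 1 ->
  discount pi phi s < discount pi phi t)
  by (intros; apply discount_increasing; lra).
assert (Hmono_le : forall s t, 0 < s -> s <= t -> t <= 1 ->
  discount pi phi s <= discount pi phi t).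
{ intros s t Hs Hst Ht; destruct Hst as [Hst | Heq];
    [left; auto | right; now rewrite Heq]. }
assert (H0 := theta0_eq_inv pi phi Hpi Hphi).
assert (Hg0 : 0 < g0 pi phi) by (unfold g0; apply Rdiv_lt_0_compat; lra).
split; [|split].
- intros phi0 [Hphi0 [Heq _]] Hlt1 Hlt s t Hs Hst Ht.
  destruct (Hred s) as [Hxs ->]; [lra|]; destruct (Hred t) as [Hxt ->]; [lra|].
  (* To the left of the crossing at [phi0], the turning point precedes [theta0]. *)
  assert (Hg : g0 pi phi < g_star pi phi).
  { assert (H1 := g_star_decreasing pi phi phi0 Hpi ltac:(lra) Hlt ltac:(lra) Hlt1).
    assert (H2 := g0_increasing pi phi phi0 Hpi ltac:(lra) Hlt ltac:(lra)).
    lra. }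
  apply fee_increasing; try lra; [apply Hmono; lra|].
  rewrite <- discount_at_vertex by lra.
  apply Hmono_le; [apply Rinv_0_lt_compat; lra | | lra].
  apply Rle_trans with (2 := Hs); rewrite H0.
  apply Rinv_le_contravar; lra.
- intros phi0 [Hphi0 [Heq _]] Hlt1 [Hle Hlt].
  (* From the crossing on, the turning point is at or after [theta0]; [Hg'] then keeps it below
     1. *)
  assert (Hg : g_star pi phi <= g0 pi phi).
  { destruct Hle as [Hl | <-]; [|lra].
    assert (H1 := g_star_decreasing pi phi0 phi Hpi ltac:(lra) Hl ltac:(lra) Hlt).
    assert (H2 := g0_increasing pi phi0 phi Hpi ltac:(lra) Hl ltac:(lra)).
    lra. }
  assert (Hg' : 0 < g_star pi phi).
  { apply lt_phi1 in Hlt; [|lra].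
    unfold g_star; apply Rdiv_lt_0_compat;
      [nra | apply g_star_denom_pos; assumption]. }
  set (ts := / (1 + g_star pi phi)).
  assert (Hv : discount pi phi ts = vertex pi phi)
    by (apply discount_at_vertex; lra).
  assert (Hts : theta0 pi phi <= ts < 1).
  { split; [rewrite H0; apply Rinv_le_contravar; lra|].
    unfold ts; rewrite <- Rinv_1; apply Rinv_lt_contravar; lra. }
  clearbody ts.
  (* The positive part of the chain rule: the derivative has the sign of [discount - vertex]. *)
  set (c := fun t => phi * (pi * (1 - phi)) ^ 2 * (2 - pi)
    / fee_denom pi phi (discount pi phi t) ^ 2 * Derive (discount pi phi) t).
  exists (fun t => c t * (discount pi phi t - vertex pi phi)), ts.
  split; [exact Hts|]; intros t Ht.
  assert (Hc : 0 < c t).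
  { destruct (Hred t Ht) as [Hx _].
    assert (Hden := fee_denom_pos pi phi _ Hpi Hphi Hx).
    unfold c; apply Rmult_lt_0_compat;
      [|apply Derive_discount_pos; lra].
    apply Rdiv_lt_0_compat; [|apply pow_lt; exact Hden].
    apply Rmult_lt_0_compat; [|lra].
    apply Rmult_lt_0_compat; [lra | apply pow_lt; nra]. }
  assert (Hless : t < ts -> discount pi phi t < vertex pi phi)
    by (intros; rewrite <- Hv; apply Hmono; lra).
  assert (Hgtr : ts < t -> vertex pi phi < discount pi phi t)
    by (intros; rewrite <- Hv; apply Hmono; lra).
  split.
  + apply is_derive_D_in with (fun t => fee pi phi (discount pi phi t));
      [exact Ht | intros s Hs; now apply Hred |].
    assert (Hx := proj1 (Hred t Ht)).
    assert (Hden := fee_denom_pos pi phi _ Hpi Hphi Hx).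
    evar_last.
    * apply (is_derive_comp (fee pi phi)); [now apply is_derive_fee|].
      apply Derive_correct, ex_derive_discount;
        [apply linear_coef_pos | apply discriminant_pos]; lra.
    * unfold scal, c; simpl; unfold mult; simpl; field; lra.
  + destruct (Rtotal_order t ts) as [Hl | [-> | Hl]].
    * specialize (Hless Hl); split; split; intros; try lra; nra.
    * rewrite Hv; split; split; intros; nra.
    * specialize (Hgtr Hl); split; split; intros; try lra; nra.
- intros [Hle _] s t Hs Hst Ht.
  destruct (Hred s) as [Hxs ->]; [lra|]; destruct (Hred t) as [Hxt ->]; [lra|].
  apply fee_decreasing; try lra; [apply Hmono; lra|].
  (* Even the largest discount, at [theta = 1], does not pass the vertex. *)
  apply Rle_trans with (discount pi phi 1);
    [apply Hmono_le; lra | now apply discount_1_le_vertex].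
Qed.
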